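(* Let $k$ be a commutative field, let $H$ be a connected bialgebra over $k$ and let $(A,p_+)$ be a Rota-Baxter algebra ($A$ a unital associative $k$-algebra). Let $j\in\mathcal U(A^{\mathrm{st}},A)$ be the linear map with $j(\emptyset)=1_A$, $j(a_1)=a_1$ and $j(a_1\otimes\cdots\otimes a_r)=0$ for $r\ge2$, and let $(j_+,j_-)\in\mathcal U(A^{\mathrm{st}},A_+)\times\mathcal U(A^{\mathrm{st}},A_-)$ be its Birkhoff-Rota-Baxter decomposition, $j_-\ast j=j_+$. Let $\varphi\in\mathcal U(H,A)$ and put $$\varphi_+=T(j_+,\varphi),\qquad\varphi_-=T(j_-,\varphi),$$ where $T(f,\varphi)=f\circ\varphi^{\mathrm{st}}\circ\iota$ for $f\in\mathcal U(A^{\mathrm{st}},A)$. Then $\varphi_+\in\mathcal U(H,A_+)$, $\varphi_-\in\mathcal U(H,A_-)$ and $$\varphi_-\ast\varphi=\varphi_+,$$ i.e. $(\varphi_+,\varphi_-)$ is the Birkhoff-Rota-Baxter decomposition of $\varphi$. If moreover $A$ is commutative and $\varphi\in\mathcal C(H,A)$, then $\varphi_+,\varphi_-\in\mathcal C(H,A)$.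
   Context: All vector spaces, algebras and tensor products are over a commutative field $k$; algebras are associative. Connected bialgebras. A bialgebra $(H,m,u,\Delta,\eta)$ is filtered if there are subspaces $H_0\subsetneq H_1\subsetneq\cdots$ with $\bigcup_{n\ge0}H_n=H$, $\Delta H_n\subseteq\sum_{i=0}^n H_i\otimes H_{n-i}$ and $H_nH_m\subseteq H_{n+m}$. It is connected if moreover $H_0=k1_H$. Put $H'=\ker\eta$, so $H=k1_H\oplus H'$, and $p'=\mathrm{Id}-u\circ\eta$. Define $\Delta^{[1]}=\mathrm{Id}$, $\Delta^{[n+1]}=(\mathrm{Id}\otimes\Delta^{[n]})\circ\Delta$, and $\Delta'^{[n]}=p'^{\otimes n}\circ\Delta^{[n]}:H'\to H'^{\otimes n}$ for $n\ge1$. For each $h\in H'$ one has $\Delta'^{[n]}(h)=0$ for $n$ large. Rota-Baxter algebra. $(A,p_+)$ is a Rota-Baxter algebra if $A$ is a unital algebra and $p_+:A\to A$ is a linear idempotent with $p_+(x)p_+(y)+p_+(xy)=p_+(xp_+(y))+p_+(p_+(x)y)$ for all $x,y\in A$. Then $p_-=\mathrm{Id}-p_+$ satisfies the same identity, $A=A_+\oplus A_-$ with $A_\pm=\operatorname{Im}p_\pm$, and $A_\pm$ are (not necessarily unital) subalgebras. Stuffle Hopf algebra. For an associative algebra $A$ (not necessarily unital), $A^{\mathrm{st}}=\bigoplus_{n\ge0}A^{\mathrm{st}}_{(n)}$ with $A^{\mathrm{st}}_{(0)}=k\emptyset$ and $A^{\mathrm{st}}_{(n)}=A^{\otimes n}$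 for $n\ge1$; $(A^{\mathrm{st}})'=\bigoplus_{n\ge1}A^{\mathrm{st}}_{(n)}$. The symbol $\otimes$ between letters is the internal (concatenation) tensor product, and $\otimes_{\mathrm{st}}$ denotes the tensor product of elements of $A^{\mathrm{st}}$. The product $m_{\mathrm{st}}$ (stuffle, or quasi-shuffle) has unit $\emptyset$ and is defined recursively, for $\mathbf a=a_1\otimes\cdots\otimes a_r$, $\mathbf b=b_1\otimes\cdots\otimes b_s$ ($r,s\ge1$), $\tilde{\mathbf a}=a_1\otimes\cdots\otimes a_{r-1}$ ($=\emptyset$ if $r=1$), $\tilde{\mathbf b}=b_1\otimes\cdots\otimes b_{s-1}$ ($=\emptyset$ if $s=1$), by $$m_{\mathrm{st}}(\mathbf a\otimes_{\mathrm{st}}\mathbf b)=m_{\mathrm{st}}(\tilde{\mathbf a}\otimes_{\mathrm{st}}\mathbf b)\otimes a_r+m_{\mathrm{st}}(\mathbf a\otimes_{\mathrm{st}}\tilde{\mathbf b})\otimes b_s+m_{\mathrm{st}}(\tilde{\mathbf a}\otimes_{\mathrm{st}}\tilde{\mathbf b})\otimes a_rb_s.$$ The counit is $\eta_{\mathrm{st}}(\emptyset)=1$, $\eta_{\mathrm{st}}=0$ on $(A^{\mathrm{st}})'$. The coproduct is deconcatenation: $\Delta_{\mathrm{st}}(\emptyset)=\emptyset\otimes_{\mathrm{st}}\emptyset$ and $\Delta_{\mathrm{st}}(a_1\otimes\cdots\otimes a_s)=\mathbf a\otimes_{\mathrm{st}}\emptyset+\emptyset\otimes_{\mathrm{st}}\mathbf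 a+\sum_{r=1}^{s-1}(a_1\otimes\cdots\otimes a_r)\otimes_{\mathrm{st}}(a_{r+1}\otimes\cdots\otimes a_s)$. With these, $A^{\mathrm{st}}$ is a connected Hopf algebra. The maps $\iota$ and $\varphi^{\mathrm{st}}$. $\iota:H\to H'^{\mathrm{st}}$ is the linear map with $\iota(1_H)=\emptyset$ and $\iota(h)=\sum_{n\ge1}\Delta'^{[n]}(h)$ for $h\in H'$, with $\Delta'^{[n]}(h)$ in the length-$n$ component. For $\varphi\in\mathcal U(H,A)$, $\varphi^{\mathrm{st}}:H'^{\mathrm{st}}\to A^{\mathrm{st}}$ is the linear map with $\varphi^{\mathrm{st}}(\emptyset)=\emptyset$ and $\varphi^{\mathrm{st}}(h_1\otimes\cdots\otimes h_r)=\varphi(h_1)\otimes\cdots\otimes\varphi(h_r)$ for $r\ge1$, $h_i\in H'$. Groups of maps. For a connected bialgebra $K$ (such as $H$ or $A^{\mathrm{st}}$) with counit $\eta_K$ and $K'=\ker\eta_K$, $\mathcal U(K,A)$ is the set of linear maps $f:K\to A$ with $f(1_K)=1_A$; it is a group under the convolution $f\ast g=m_A\circ(f\otimes g)\circ\Delta_K$ ($m_A$ the product of $A$). For a subalgebra $B\subset A$ (possibly non-unital), $\mathcal U(K,B)=\{f\in\mathcal U(K,A):f(K')\subset B\}$. $\mathcal C(K,A)\subset\mathcal U(K,A)$ is the subset of unital algebra morphisms (characters). Birkhoff-Rota-Baxter decomposition. For $\psi\in\mathcal U(K,A)$ it is the unique pair $(\psi_+,\psi_-)\in\mathcal U(K,A_+)\times\mathcal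 U(K,A_-)$ with $\psi_-\ast\psi=\psi_+$ (existence and uniqueness are well known). *)

(* Defs.v *)
From HB Require Import structures.
From mathcomp Require Import all_boot all_algebra all_classical.
From mathcomp Require Import finmap monalg.

Set Implicit Arguments.
Unset Strict Implicit.
Unset Printing Implicit Defensive.

Import GRing.Theory.
Local Open Scope classical_set_scope.
Local Open Scope ring_scope.
Local Open Scope quotient_scope.

(* Quotient of a module by the submodule generated by a set of relations. *)
Section Quotient.
Context {k : fieldType} {M : lmodType k}.

Definition spanned (S : set M) : set M := [set x |
  exists s : seq (k * M), (forall p, p \in s -> S p.2) /\
    x = \sum_(p <- s) p.1 *: p.2].

Lemma spanned_linear (S : set M) a x y :
  spanned S x -> spanned S y -> spanned S (a *: x + y).
Proof.
move=> [s [hs ->]] [t [ht ->]].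
exists ([seq (a * p.1, p.2) | p <- s] ++ t); split=> [p|].
  by rewrite mem_cat => /orP[/mapP[q qs ->]|/ht//]; exact: (hs q qs).
rewrite big_cat big_map scaler_sumr; congr (_ + _).
by apply: eq_bigr => p _; rewrite scalerA.
Qed.

Lemma spanned0 (S : set M) : spanned S 0.
Proof. by exists [::]; split=> //; rewrite big_nil. Qed.

Lemma spannedN (S : set M) x : spanned S x -> spanned S (- x).
Proof.
move=> hx; rewrite -scaleN1r -[_ *: _]addr0.
by apply: spanned_linear => //; exact: spanned0.
Qed.

Lemma spannedD (S : set M) x y : spanned S x -> spanned S y -> spanned S (x + y).
Proof. by move=> hx hy; rewrite -[x]scale1r; apply: spanned_linear. Qed.

Lemma spanned_mem (S : set M) x : S x -> spanned S x.
Proof.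
move=> Sx; exists [:: (1, x)]; split; last by rewrite big_seq1 scale1r.
by move=> p; rewrite inE => /eqP->.
Qed.

Definition quot_rel (S : set M) : rel M := fun x y => `[< spanned S (x - y) >].

Fact quot_rel_equiv (S : set M) : equiv_class_of (quot_rel S).
Proof.
split=> [x|x y|y x z].
- by apply/asboolP; rewrite subrr; apply: spanned0.
- by apply/asboolP/asboolP => /spannedN; rewrite opprB.
- move=> /asboolP xy /asboolP yz; apply/asboolP.
  by rewrite -[x](subrK y) -addrA; apply: spannedD.
Qed.

Canonical quot_equiv (S : set M) := EquivRelPack (quot_rel_equiv S).

Definition quotmod (S : set M) := {eq_quot (quot_equiv S)}.
HB.instance Definition _ S := Choice.on (quotmod S).
HB.instance Definition _ S := EqQuotient.on (quotmod S).

Variable S : set M.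
Local Notation Q := (quotmod S).
Local Notation pr := (\pi_Q).

Lemma quotP x y : pr x = pr y <-> spanned S (x - y).
Proof.
split=> [/(@eqmodP _ (quot_equiv S))/asboolP //|h].
by apply/(@eqmodP _ (quot_equiv S))/asboolP.
Qed.

Let qadd (x y : Q) : Q := pr (repr x + repr y).
Let qopp (x : Q) : Q := pr (- repr x).
Let qscale (a : k) (x : Q) : Q := pr (a *: repr x).

Let repr_pi x : spanned S (repr (pr x) - x).
Proof. by apply/quotP; rewrite reprK. Qed.

Let qaddE x y : qadd (pr x) (pr y) = pr (x + y).
Proof. by apply/quotP; rewrite opprD addrACA; apply: spannedD. Qed.
Let qoppE x : qopp (pr x) = pr (- x).
Proof. by apply/quotP; rewrite -opprD; apply: spannedN. Qed.
Let qscaleE a x : qscale a (pr x) = pr (a *: x).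
Proof.
apply/quotP; rewrite -scalerBr -[_ *: _]addr0.
by apply: spanned_linear => //; exact: spanned0.
Qed.

Let qind (P : Q -> Prop) : (forall x, P (pr x)) -> forall x, P x.
Proof. by move=> h x; rewrite -[x]reprK. Qed.

Let qaddA : associative qadd.
Proof.
elim/qind=> x; elim/qind=> y; elim/qind=> z.
by rewrite !qaddE addrA.
Qed.
Let qaddC : commutative qadd.
Proof. by elim/qind=> x; elim/qind=> y; rewrite !qaddE addrC. Qed.
Let qadd0 : left_id (pr 0) qadd.
Proof. by elim/qind=> x; rewrite qaddE add0r. Qed.
Let qaddN : left_inverse (pr 0) qopp qadd.
Proof. by elim/qind=> x; rewrite qoppE qaddE addNr. Qed.

HB.instance Definition _ := GRing.isZmodule.Build Q qaddA qaddC qadd0 qaddN.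

Let qscaleA a b x : qscale a (qscale b x) = qscale (a * b) x.
Proof. by elim/qind: x => x; rewrite !qscaleE scalerA. Qed.
Let qscale1 : left_id 1 qscale.
Proof. by elim/qind=> x; rewrite qscaleE scale1r. Qed.
Let qscaleDr : right_distributive qscale +%R.
Proof.
move=> a; elim/qind=> x; elim/qind=> y.
by rewrite [_ + _]qaddE !qscaleE scalerDr [RHS]qaddE.
Qed.
Let qscaleDl x : {morph qscale^~ x : a b / a + b}.
Proof.
by move=> a b; elim/qind: x => x; rewrite !qscaleE scalerDl [RHS]qaddE.
Qed.

HB.instance Definition _ :=
  GRing.Zmodule_isLmodule.Build k Q qscaleA qscale1 qscaleDr qscaleDl.

Lemma pi_is_linear : linear pr.
Proof. by move=> a x y; rewrite -qaddE -qscaleE. Qed.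

Lemma quot_rel0 x : S x -> pr x = 0.
Proof. by move=> Sx; apply/quotP; rewrite subr0; apply: spanned_mem. Qed.

End Quotient.

(* Linear extension to {malg k[T]}, the free module on T, and to its quotients.
   [qlift f] is the map induced by [f] when [f] respects the relations
   ([qlift_pi], [qlift_linear]), and has no meaning otherwise. *)
Section Lift.
Context {k : fieldType} {T : choiceType} {U : lmodType k}.
Implicit Types (f : T -> U) (g : {malg k[T]}).

Definition flift f g : U := \sum_(x <- msupp g) g@_x *: f x.

Lemma flift_wide f g (D : {fset T}) : fsubset (msupp g) D ->
  flift f g = \sum_(x <- D) g@_x *: f x.
Proof.
move=> /fsubsetP sub; rewrite /flift [RHS](bigID (mem (msupp g))) /=.
rewrite [X in _ = _ + X]big1 ?addr0 => [|x /mcoeff_outdom->]; last exact: scale0r.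
rewrite -[RHS]big_filter; apply/perm_big/uniq_perm => //.
  exact/filter_uniq/fset_uniq.
by move=> x; rewrite mem_filter; case: (boolP (_ \in _)) => //= /sub ->.
Qed.

Lemma flift_linear f : linear (flift f).
Proof.
move=> a g h.
pose D : {fset T} := fsetU (msupp g) (fsetU (msupp h) (msupp (a *: g + h))).
have Dg : fsubset (msupp g) D by exact: fsubsetUl.
have Dh : fsubset (msupp h) D by rewrite /D fsetUCA fsubsetUl.
have Dgh : fsubset (msupp (a *: g + h)) D by rewrite /D fsetUA fsubsetUr.
rewrite (flift_wide f Dg) (flift_wide f Dh) (flift_wide f Dgh).
rewrite scaler_sumr -big_split /=.
apply: eq_bigr => x _.
by rewrite mcoeffD mcoeffZ scalerDl scalerA.
Qed.

Lemma fliftU f x : flift f << x >> = f x.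
Proof. by rewrite /flift msuppU oner_eq0 big_seq_fset1 mcoeffUU scale1r. Qed.

Definition qlift (S : set {malg k[T]}) f (t : quotmod S) : U := flift f (repr t).

Variables (S : set {malg k[T]}) (f : T -> U).
Hypothesis fS : forall g, S g -> flift f g = 0.

Let fL := GRing.isLinear.Build _ _ _ _ (flift f) (flift_linear f).
Let fl : {linear {malg k[T]} -> U} := HB.pack (flift f) fL.

Lemma qlift_pi g : qlift f (\pi_(quotmod S) g) = flift f g.
Proof.
apply/eqP; rewrite -subr_eq0 /qlift -[_ - _](raddfB fl); apply/eqP.
have /quotP[s [hs ->]] : \pi_(quotmod S) (repr (\pi_(quotmod S) g)) = \pi g.
  by rewrite reprK.
rewrite (raddf_sum fl) big_seq big1 // => p /hs /fS h.
by rewrite [LHS](linearZ_LR fl) /= h scaler0.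
Qed.

Lemma qlift_linear : linear (qlift f : quotmod S -> U).
Proof.
move=> a x y; rewrite -[x]reprK -[y]reprK -pi_is_linear !qlift_pi.
exact: flift_linear.
Qed.

End Lift.

(* The tensor product: the free module on pairs, modulo bilinearity. *)
Section Tensor.
Context {k : fieldType}.

Definition tensor_rel (V W : lmodType k) : set {malg k[(V * W)%type]} := [set g |
  (exists a x y w, g = << (a *: x + y, w) >> - (a *: << (x, w) >> + << (y, w) >>)) \/
  (exists a v x y, g = << (v, a *: x + y) >> - (a *: << (v, x) >> + << (v, y) >>))].

Definition tensor (V W : lmodType k) := quotmod (@tensor_rel V W).
HB.instance Definition _ V W := GRing.Lmodule.copy (tensor V W)
  (quotmod (@tensor_rel V W)).

Definition tens (V W : lmodType k) (v : V) (w : W) : tensor V W :=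
  \pi_(quotmod (@tensor_rel V W)) << (v, w) >>.

(* The linear map [v (x) w |-> b v w]; meaningful when [b] is bilinear. *)
Definition tlift (V W U : lmodType k) (b : V -> W -> U) : tensor V W -> U :=
  @qlift k (V * W)%type U _ (fun p => b p.1 p.2).

End Tensor.

Notation "v \ox w" := (tens v w) (at level 40, left associativity) : ring_scope.

Section TensorTheory.
Context {k : fieldType}.
Implicit Types U V W : lmodType k.

Lemma tens_linearl V W (w : W) : linear (fun v : V => v \ox w).
Proof.
move=> a x y; apply/eqP; rewrite -subr_eq0 /tens -!pi_is_linear.
rewrite -scaleN1r addrC -pi_is_linear scaleN1r addrC.
by apply/eqP/quot_rel0; left; exists a, x, y, w.
Qed.

Lemma tens_linearr V W (v : V) : linear (fun w : W => v \ox w).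
Proof.
move=> a x y; apply/eqP; rewrite -subr_eq0 /tens -!pi_is_linear.
rewrite -scaleN1r addrC -pi_is_linear scaleN1r addrC.
by apply/eqP/quot_rel0; right; exists a, v, x, y.
Qed.

Section Bilinear.
Variables (U V W : lmodType k) (b : V -> W -> U).
Hypothesis (bl : forall w, linear (b^~ w)) (br : forall v, linear (b v)).

Let b_rel g : @tensor_rel k V W g -> flift (fun p => b p.1 p.2) g = 0.
Proof.
have L := flift_linear (fun p : V * W => b p.1 p.2).
move=> [[a [x [y [w ->]]]]|[a [v [x [y ->]]]]].
  by rewrite addrC -scaleN1r !L !fliftU /= bl scaleN1r addNr.
by rewrite addrC -scaleN1r !L !fliftU /= br scaleN1r addNr.
Qed.

Lemma tliftE v w : tlift b (v \ox w) = b v w.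
Proof. by rewrite /tlift /tens qlift_pi // fliftU. Qed.

Lemma tlift_linear : linear (tlift b).
Proof. exact: qlift_linear. Qed.

End Bilinear.

Lemma tensor_sum V W (t : tensor V W) :
  exists s : seq (V * W), t = \sum_(p <- s) p.1 \ox p.2.
Proof.
pose L := GRing.isLinear.Build _ _ _ _ _ (@pi_is_linear k _ (@tensor_rel k V W)).
pose pr : {linear _ -> tensor V W} := HB.pack (\pi_(quotmod (@tensor_rel k V W))) L.
exists [seq ((repr t)@_p *: p.1, p.2) | p <- msupp (repr t)].
rewrite big_map /= -[LHS]reprK [X in \pi X]monalgE -[LHS]/(pr _) raddf_sum.
apply: eq_bigr => -[v w] _ /=.
have := @tens_linearl V W w (repr t)@_(v, w) v 0; rewrite addr0 => ->.
have := @tens_linearl V W w (-1) 0 0; rewrite scaler0 addr0 scaleN1r addNr => ->.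
rewrite addr0 -[RHS](linearZ_LR pr); congr (pr _).
by apply/malgP => x; rewrite mcoeffZ !mcoeffU mulrnAr mulr1.
Qed.

End TensorTheory.

Section TensorMaps.
Context {k : fieldType}.

Definition tmap (V V' W W' : lmodType k) (f : V -> V') (g : W -> W') :
    tensor V W -> tensor V' W' :=
  tlift (fun v w => f v \ox g w).

Definition tassoc (U V W : lmodType k) :
    tensor (tensor U V) W -> tensor U (tensor V W) :=
  tlift (fun uv w => tlift (fun u v => u \ox (v \ox w)) uv).

Definition tmul (B : algType k) (s t : tensor B B) : tensor B B :=
  tlift (fun a b => tlift (fun c d => (a * c) \ox (b * d)) t) s.

End TensorMaps.

(* [st V] is the direct sum of all tensor powers of V: the free module on
   words, modulo linearity in each letter. The relations are homogeneous, and
   V^{(x) n} is the image of the words of size n. *)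
Section Words.
Context {k : fieldType}.

Definition st_rel (V : lmodType k) : set {malg k[seq V]} := [set g |
  exists u v a x y, g = << u ++ (a *: x + y) :: v >>
    - (a *: << u ++ x :: v >> + << u ++ y :: v >>)].

Definition st (V : lmodType k) := quotmod (@st_rel V).
HB.instance Definition _ V := GRing.Lmodule.copy (st V) (quotmod (@st_rel V)).

Definition word (V : lmodType k) (w : seq V) : st V :=
  \pi_(quotmod (@st_rel V)) << w >>.

(* The linear map [word w |-> f w]; meaningful when [f] is multilinear. *)
Definition st_lift (V U : lmodType k) (f : seq V -> U) : st V -> U :=
  @qlift k (seq V) U _ f.

Definition multilinear (V U : lmodType k) (f : seq V -> U) :=
  forall u v : seq V, linear (fun x => f (u ++ x :: v)).

Lemma word_multilinear V : multilinear (@word V).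
Proof.
move=> u v a x y; apply/eqP; rewrite -subr_eq0 /word -!pi_is_linear.
rewrite -scaleN1r addrC -pi_is_linear scaleN1r addrC.
by apply/eqP/quot_rel0; exists u, v, a, x, y.
Qed.

Section Multilinear.
Variables (V U : lmodType k) (f : seq V -> U).
Hypothesis fM : multilinear f.

Let f_rel g : @st_rel V g -> flift f g = 0.
Proof.
have L := flift_linear f.
move=> [u [v [a [x [y ->]]]]].
by rewrite addrC -scaleN1r !L !fliftU fM scaleN1r addNr.
Qed.

Lemma st_liftE w : st_lift f (word w) = f w.
Proof. by rewrite /st_lift /word qlift_pi // fliftU. Qed.

Lemma st_lift_linear : linear (st_lift f).
Proof. exact: qlift_linear. Qed.

End Multilinear.

Definition st_map (V W : lmodType k) (f : V -> W) : st V -> st W :=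
  st_lift (fun w => word (map f w)).

Definition st_cons (V : lmodType k) (x : V) : st V -> st V :=
  st_lift (fun w => word (x :: w)).

Definition st_counit (V : lmodType k) : st V -> k :=
  st_lift (fun w => (w == [::])%:R : k^o).

Definition st_coprod (V : lmodType k) : st V -> tensor (st V) (st V) :=
  st_lift (fun w => \sum_(i < (size w).+1) word (take i w) \ox word (drop i w)).

Lemma st_map_multilinear (V W : lmodType k) (f : V -> W) :
  linear f -> multilinear (fun w => word (map f w)).
Proof.
by move=> fL u v a x y; rewrite /= !map_cat /= fL word_multilinear.
Qed.

Lemma st_cons_multilinear (V : lmodType k) (x : V) :
  multilinear (fun w => word (x :: w)).
Proof. by move=> u v; exact: (@word_multilinear V (x :: u) v). Qed.

Lemma st_counit_multilinear (V : lmodType k) :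
  multilinear (fun w : seq V => (w == [::])%:R : k^o).
Proof. by move=> [|? ?] v a x y /=; rewrite scaler0 addr0. Qed.

Lemma st_coprod_multilinear (V : lmodType k) : multilinear (fun w : seq V =>
  \sum_(i < (size w).+1) word (take i w) \ox word (drop i w)).
Proof.
move=> u v a x y; rewrite !size_cat /= scaler_sumr -big_split /=.
apply: eq_bigr => i _; rewrite !take_cat !drop_cat.
case: ltnP => ui.
  by rewrite word_multilinear tens_linearr.
case: (i - size u)%N => [|j] /=.
  by rewrite (@word_multilinear V [::] v) tens_linearr.
by rewrite word_multilinear tens_linearl.
Qed.

Lemma st_counitE (V : lmodType k) (w : seq V) :
  st_counit (word w) = (w == [::])%:R.
Proof. by rewrite /st_counit st_liftE //; exact: st_counit_multilinear. Qed.

Lemma st_coprodE (V : lmodType k) (w : seq V) : st_coprod (word w) =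
  \sum_(i < (size w).+1) word (take i w) \ox word (drop i w).
Proof. by rewrite /st_coprod st_liftE //; exact: st_coprod_multilinear. Qed.

End Words.

(* Bialgebras: the product and unit of H are those of its algType structure. *)
Section Bialgebra.
Context {k : fieldType} {H : algType k}.
Variables (Delta : {linear H -> tensor H H}) (eta : {linear H -> k^o}).

Record bialgebra : Prop := {
  coassoc : forall x,
    tassoc (tmap Delta id (Delta x)) = tmap id Delta (Delta x);
  counitl : forall x, tlift (fun a b => (eta a : k) *: b) (Delta x) = x;
  counitr : forall x, tlift (fun a b => (eta b : k) *: a) (Delta x) = x;
  comult1 : Delta 1 = 1 \ox 1;
  comultM : forall x y, Delta (x * y) = tmul (Delta x) (Delta y);
  counit1 : eta 1 = 1;
  counitM : forall x y, eta (x * y) = (eta x : k) * eta y }.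

(* In [filt_comult], the sum over s is the general element of
   \sum_(i <= n) F i (x) F (n - i), since each F i is a subspace. *)
Record connected_filtration (F : nat -> set H) : Prop := {
  filt_submod : forall n, submod_closed (mem (F n));
  filt_proper : forall n, F n `<` F n.+1;
  filt_cover : \bigcup_n F n = setT;
  filt_comult : forall n x, F n x -> exists s : seq (H * H),
    (forall p, p \in s -> exists i, [/\ (i <= n)%N, F i p.1 & F (n - i)%N p.2]) /\
    Delta x = \sum_(p <- s) p.1 \ox p.2;
  filt_mul : forall n m x y, F n x -> F m y -> F (n + m)%N (x * y);
  filt_connected : F 0%N = [set a *: 1 | a in [set: k]] }.

Definition connected_bialgebra : Prop :=
  bialgebra /\ exists F, connected_filtration F.

End Bialgebra.

Section Augmentation.
Context {k : fieldType} {H : algType k}.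
Variables (Delta : {linear H -> tensor H H}) (eta : {linear H -> k^o}).

Definition aug_pred : {pred H} := fun x => eta x == 0.

Fact aug_closed : submod_closed aug_pred.
Proof.
split=> [|a x y]; rewrite !unfold_in ?linear0 //.
by move=> /eqP hx /eqP hy; rewrite linearP hx hy scaler0 addr0.
Qed.
HB.instance Definition _ := GRing.isSubmodClosed.Build k H aug_pred aug_closed.

Definition aug := {x : H | aug_pred x}.
HB.instance Definition _ := SubChoice.on aug.
HB.instance Definition _ := [SubChoice_isSubLmodule of aug by <:].

(* p' = Id - u o eta, corestricted to ker eta (the default value of [insubd]
   is not used as soon as eta 1 = 1). *)
Definition aug_proj (h : H) : aug := insubd (0 : aug) (h - (eta h : k) *: 1).

Lemma aug_projE h : eta 1 = 1 ->
  val (aug_proj h) = h - (eta h : k) *: 1.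
Proof.
move=> eta1; rewrite val_insubd; suff -> : aug_pred (h - (eta h : k) *: 1) by [].
by rewrite /aug_pred linearB linearZ /= eta1 [_ *: _]mulr1 subrr.
Qed.

(* Delta^{[n + 1]} *)
Fixpoint coprod_iter (n : nat) : H -> st H :=
  match n with
  | 0 => fun h => word [:: h]
  | n'.+1 => fun h => tlift (fun x y => st_cons x (coprod_iter n' y)) (Delta h)
  end.

(* Delta'^{[n + 1]} *)
Definition red_coprod_iter (n : nat) (h : aug) : st aug :=
  st_map aug_proj (coprod_iter n (val h)).

(* The sum is over the finitely many n with a nonzero summand. *)
Definition iota_st (h : H) : st aug :=
  (eta h : k) *: word [::] +
  \sum_(n \in [set: nat]) red_coprod_iter n (aug_proj h).

Definition phi_st (A : algType k) (phi : H -> A) : st aug -> st A :=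
  st_map (fun h : aug => phi (val h)).

Definition transfer (A : algType k) (f : st A -> A) (phi : H -> A) : H -> A :=
  fun h => f (phi_st phi (iota_st h)).

End Augmentation.

(* U(K, A), U(K, B), convolution and Birkhoff-Rota-Baxter decompositions only
   involve the coproduct, the counit and the unit element e of K. A_+ and A_-
   are the ranges of p and of Id - p. *)
Section Birkhoff.
Context {k : fieldType} {A : algType k}.

Record Rota_Baxter (p : A -> A) : Prop := {
  RB_linear : linear p;
  RB_idem : forall x, p (p x) = p x;
  RB_eq : forall x y, p x * p y + p (x * y) = p (x * p y) + p (p x * y) }.

Section Coalgebra.
Context {K : lmodType k}.
Variables (Delta : K -> tensor K K) (eta : K -> k) (e : K).
Implicit Types f g : K -> A.

Definition inU f : Prop := linear f /\ f e = 1.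

Definition inU_sub (B : set A) f : Prop :=
  inU f /\ forall x, eta x = 0 -> B (f x).

Definition conv f g : K -> A :=
  fun x => tlift (fun a b => f a * g b) (Delta x).

Definition Birkhoff_decomp (p : A -> A) (psi psip psim : K -> A) : Prop :=
  [/\ inU_sub (range p) psip,
      inU_sub (range (fun x => x - p x)) psim
    & conv psim psi = psip].

End Coalgebra.

Definition st_Birkhoff_decomp :=
  @Birkhoff_decomp (st A) (@st_coprod k A) (@st_counit k A) (word [::]).

Definition inC {H : algType k} (f : H -> A) : Prop :=
  inU 1 f /\ forall x y, f (x * y) = f x * f y.

Definition st_j : st A -> A :=
  st_lift (fun w => match w with [::] => 1 | [:: a] => a | _ => 0 end).

Lemma st_j_multilinear : multilinear
  (fun w : seq A => match w with [::] => 1 | [:: a] => a | _ => 0 end).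
Proof.
move=> u v a x y.
by case: u v => [|? [|? ?]] [|? ?] //=; rewrite scaler0 addr0.
Qed.

Lemma st_jE w : st_j (word w) = match w with [::] => 1 | [:: a] => a | _ => 0 end.
Proof. by rewrite /st_j st_liftE //; exact: st_j_multilinear. Qed.

Lemma st_j_linear : linear st_j.
Proof. exact: st_lift_linear st_j_multilinear. Qed.

End Birkhoff.

(* Main.v *)
From HB Require Import structures.
Require Import Defs.
From mathcomp Require Import all_boot all_algebra all_classical.
From mathcomp Require Import finmap monalg.

Set Implicit Arguments.
Unset Strict Implicit.
Unset Printing Implicit Defensive.

Import GRing.Theory.
Local Open Scope ring_scope.

(* Since deconcatenation of a word w a against j only keeps the two cuts w a | 1
   and w | a, the convolution f * j is f (w a) + f (w) a on w a; splitting off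
   the last letter of the iterated coproduct by coassociativity,
   T(f * j, phi) = T(f, phi) * phi for every linear f, and f = j_- gives the
   decomposition of phi.

   The characters need no stuffle product: for the decomposition (phi_+, phi_-)
   of a character phi into a commutative algebra, put
   d_-(x, y) = phi_-(x y) - phi_-(x) phi_-(y), and d_+ likewise.  Then
   d_+(x, y) = sum d_-(x_1, y_1) phi(x_2) phi(y_2), so by induction on the
   filtration degree of (x, y) only the terms with x_2 and y_2 scalar survive
   and d_+(x, y) = d_-(x, y).  This lies in A_+ and A_-, hence is 0. *)

(** * Linear maps as a predicate, and linear extension to tensors *)

Section LinearPredicate.
Context {k : fieldType} {U V : lmodType k}.
Variable f : U -> V.
Hypothesis fL : linear f.

Let F : {linear U -> V} := HB.pack f (GRing.isLinear.Build _ _ _ _ f fL).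

Lemma lin0 : f 0 = 0. Proof. exact: (raddf0 F). Qed.

Lemma linD x y : f (x + y) = f x + f y. Proof. exact: (raddfD F). Qed.

Lemma linB x y : f (x - y) = f x - f y. Proof. exact: (raddfB F). Qed.

Lemma linZ a x : f (a *: x) = a *: f x. Proof. exact: (linearZ_LR F). Qed.

Lemma lin_sum (I : Type) (r : seq I) (P : pred I) (E : I -> U) :
  f (\sum_(i <- r | P i) E i) = \sum_(i <- r | P i) f (E i).
Proof. exact: (raddf_sum F). Qed.

End LinearPredicate.

Lemma comp_linear (k : fieldType) (U V W : lmodType k) (g : V -> W) (f : U -> V) :
  linear g -> linear f -> linear (fun x => g (f x)).
Proof. by move=> gL fL a x y; rewrite fL gL. Qed.

Lemma sum_linear (k : fieldType) (U V : lmodType k) (I : Type) (r : seq I)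
    (f : I -> U -> V) :
  (forall i, linear (f i)) -> linear (fun x => \sum_(i <- r) f i x).
Proof.
move=> fL a x y; rewrite scaler_sumr -big_split.
by apply: eq_bigr => i _; rewrite fL.
Qed.

Lemma sub_linear (k : fieldType) (U V : lmodType k) (f g : U -> V) :
  linear f -> linear g -> linear (fun x => f x - g x).
Proof. by move=> fL gL a x y; rewrite fL gL scalerBr opprD addrACA. Qed.

Lemma mulr_linearl (k : fieldType) (A : algType k) (y : A) :
  linear (fun x : A => x * y).
Proof. by move=> a x x'; rewrite mulrDl scalerAl. Qed.

Lemma mulr_linearr (k : fieldType) (A : algType k) (x : A) :
  linear (fun y : A => x * y).
Proof. by move=> a y y'; rewrite mulrDr scalerAr. Qed.

Lemma tlift_sum (k : fieldType) (U V W : lmodType k) (b : V -> W -> U)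
    (s : seq (V * W)) :
  (forall w, linear (b^~ w)) -> (forall v, linear (b v)) ->
  tlift b (\sum_(p <- s) p.1 \ox p.2) = \sum_(p <- s) b p.1 p.2.
Proof.
move=> bl br; rewrite (lin_sum (tlift_linear bl br)).
by apply: eq_bigr => p _; rewrite tliftE.
Qed.

(** A lift is evaluated on a representative of [t] chosen independently of the function lifted, so
    [tlift (b x) t] is a combination of values [b x v w] whose coefficients do not involve [x]. *)
Lemma tlift_param_linear (k : fieldType) (U V W X : lmodType k)
    (b : X -> V -> W -> U) t :
  (forall v w, linear (fun x => b x v w)) -> linear (fun x => tlift (b x) t).
Proof.
move=> bL a x y; rewrite /tlift /qlift /flift scaler_sumr -big_split.
by apply: eq_bigr => p _; rewrite bL scalerDr !scalerA mulrC.
Qed.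

Lemma tassoc_tens (k : fieldType) (U V W : lmodType k) (s : seq (U * V)) (w : W) :
  tassoc ((\sum_(p <- s) p.1 \ox p.2) \ox w) =
  \sum_(p <- s) p.1 \ox (p.2 \ox w).
Proof.
have L2 (u : U) z : linear (fun v : V => u \ox (v \ox z : tensor V W)).
  exact: (comp_linear (tens_linearr u) (tens_linearl z)).
have L3 (u : U) (v : V) : linear (fun z : W => u \ox (v \ox z)).
  exact: (comp_linear (tens_linearr u) (tens_linearr v)).
have L1 v z : linear (fun u : U => u \ox (v \ox z : tensor V W)).
  exact: tens_linearl.
rewrite /tassoc tliftE.
- by rewrite tlift_sum.
- by move=> z; apply: tlift_linear.
- by move=> t; apply: tlift_param_linear.
Qed.

Lemma tassoc_linear (k : fieldType) (U V W : lmodType k) :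
  linear (@tassoc k U V W).
Proof.
apply: tlift_linear => [z|t].
  apply: tlift_linear => [v|u]; first exact: tens_linearl.
  exact: (comp_linear (tens_linearr u) (tens_linearl z)).
apply: tlift_param_linear => u v.
exact: (comp_linear (tens_linearr u) (tens_linearr v)).
Qed.

(** * Linear maps out of the space of words *)

Section WordLift.
Context {k : fieldType} {V : lmodType k}.
Implicit Types (U W : lmodType k) (t : st V).

Lemma st_sum t : exists s : seq (k * seq V), t = \sum_(p <- s) p.1 *: word p.2.
Proof.
pose L := GRing.isLinear.Build _ _ _ _ _ (@pi_is_linear k _ (@st_rel k V)).
pose pr : {linear _ -> st V} := HB.pack (\pi_(quotmod (@st_rel k V)))%qT L.
exists [seq ((repr t)@_w, w) | w <- msupp (repr t)].
rewrite big_map -[LHS]reprK [X in (\pi X)%qT]monalgE -[LHS]/(pr _) raddf_sum.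
apply: eq_bigr => w _ /=; rewrite -[RHS](linearZ_LR pr); congr (pr _).
by apply/malgP => x; rewrite mcoeffZ !mcoeffU mulrnAr mulr1.
Qed.

Lemma eq_st_linear U (f g : st V -> U) :
  linear f -> linear g -> (forall w, f (word w) = g (word w)) -> f =1 g.
Proof.
move=> fL gL fg t; have [s ->] := st_sum t.
rewrite (lin_sum fL) (lin_sum gL); apply: eq_bigr => p _.
by rewrite (linZ fL) (linZ gL) fg.
Qed.

Lemma st_lift_comp U W (f : U -> W) (g : seq V -> U) t :
  linear f -> multilinear g -> f (st_lift g t) = st_lift (fun w => f (g w)) t.
Proof.
move=> fL gM.
have fgM : multilinear (fun w => f (g w)) by move=> u v; apply: comp_linear.
move: t; apply: eq_st_linear => [||w].
- exact/comp_linear/st_lift_linear.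
- exact: st_lift_linear.
- by rewrite !st_liftE.
Qed.

Lemma st_consE (x : V) w : st_cons x (word w) = word (x :: w).
Proof. by rewrite /st_cons st_liftE //; exact: st_cons_multilinear. Qed.

Lemma st_cons_linearr (x : V) : linear (st_cons x).
Proof. exact/st_lift_linear/st_cons_multilinear. Qed.

(** Here [x] is a parameter of the lift and not its argument: once [t] is expanded into words,
    multilinearity of [word] in the first letter applies. *)
Lemma st_cons_linearl t : linear (fun x => st_cons x t).
Proof.
move=> a x y; have [s ->] := st_sum t.
rewrite !(lin_sum (@st_cons_linearr _)) scaler_sumr -big_split /=.
apply: eq_bigr => p _; rewrite !(linZ (@st_cons_linearr _)) !st_consE.
by rewrite (word_multilinear [::]) scalerDr !scalerA mulrC.
Qed.

Lemma multilinear_cons U (g : seq V -> U) x :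
  multilinear g -> multilinear (fun w => g (x :: w)).
Proof. by move=> gM u v; exact: (gM (x :: u) v). Qed.

Lemma multilinear_rcons U (g : seq V -> U) x :
  multilinear g -> multilinear (fun w => g (rcons w x)).
Proof.
move=> gM u v a y z; rewrite !rcons_cat /=.
exact: (gM u (rcons v x)).
Qed.

Lemma st_lift_cons U (g : seq V -> U) x t :
  multilinear g -> st_lift g (st_cons x t) = st_lift (fun w => g (x :: w)) t.
Proof.
move=> gM; rewrite [LHS]st_lift_comp; first last.
- exact: st_cons_multilinear.
- exact: st_lift_linear.
by congr st_lift; apply/funext => w; rewrite st_liftE.
Qed.

End WordLift.

(** * Iterated coproducts, evaluated against multilinear functions *)

Section IteratedCoproduct.
Context {k : fieldType} {H : algType k}.
Variable Delta : {linear H -> tensor H H}.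
Implicit Types (U W : lmodType k) (n : nat) (h : H).

Local Notation coprod_iter := (coprod_iter Delta).

Lemma coprod_iter_linear n : linear (coprod_iter n).
Proof.
elim: n => [|n IHn]; first exact: (word_multilinear [::] [::]).
apply: (@comp_linear _ _ _ _ _ Delta); last exact: linearP.
apply: tlift_linear => [y|x]; first exact: st_cons_linearl.
exact/comp_linear/IHn/st_cons_linearr.
Qed.

Lemma coprod_iterS n h s : Delta h = \sum_(p <- s) p.1 \ox p.2 ->
  coprod_iter n.+1 h = \sum_(p <- s) st_cons p.1 (coprod_iter n p.2).
Proof.
move=> /= ->; apply: (tlift_sum (b := fun x y => st_cons x (coprod_iter n y))).
  by move=> y; exact: st_cons_linearl.
by move=> x; exact/comp_linear/coprod_iter_linear/st_cons_linearr.
Qed.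

(* [g] applied to Delta^{[n + 1]} h: as for [coprod_iter], the index is off by
   one from the paper. *)
Definition ev n U (g : seq H -> U) h : U := st_lift g (coprod_iter n h).

Lemma ev_linear n U (g : seq H -> U) : multilinear g -> linear (ev n g).
Proof. by move=> gM; exact/comp_linear/coprod_iter_linear/st_lift_linear. Qed.

Lemma ev0 U (g : seq H -> U) h : multilinear g -> ev 0 g h = g [:: h].
Proof. by move=> gM; exact: st_liftE. Qed.

Lemma evS n U (g : seq H -> U) h s : multilinear g ->
  Delta h = \sum_(p <- s) p.1 \ox p.2 ->
  ev n.+1 g h = \sum_(p <- s) ev n (fun w => g (p.1 :: w)) p.2.
Proof.
move=> gM hs; rewrite /ev (coprod_iterS _ hs) (lin_sum (st_lift_linear gM)).
by apply: eq_bigr => p _; rewrite st_lift_cons.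
Qed.

Lemma ev_comp n U W (f : U -> W) (g : seq H -> U) h :
  linear f -> multilinear g -> f (ev n g h) = ev n (fun w => f (g w)) h.
Proof. exact: st_lift_comp. Qed.

(** The representative of the iterated coproduct that is evaluated depends on [n] and [h] only. This
    gives linearity in a letter that the function carries as a parameter. *)
Lemma ev_lin n U a (f g : seq H -> U) h :
  ev n (fun w => a *: f w + g w) h = a *: ev n f h + ev n g h.
Proof.
rewrite /ev /st_lift /qlift /flift scaler_sumr -big_split.
by apply: eq_bigr => w _; rewrite scalerDr !scalerA mulrC.
Qed.

Lemma ev_eq0 n U (g : seq H -> U) h : (forall w, g w = 0) -> ev n g h = 0.
Proof.
by move=> g0; rewrite /ev /st_lift /qlift /flift big1 // => w _; rewrite g0 scaler0.
Qed.

Lemma ev_cons_linear n U (g : seq H -> U) h :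
  multilinear g -> linear (fun x => ev n (fun w => g (x :: w)) h).
Proof.
move=> gM a x y; rewrite -ev_lin; congr (ev n _ h).
by apply/funext => w; exact: (gM [::]).
Qed.

Lemma ev_rcons_linear n U (g : seq H -> U) h :
  multilinear g -> linear (fun x => ev n (fun w => g (rcons w x)) h).
Proof.
move=> gM a x y; rewrite -ev_lin; congr (ev n _ h).
by apply/funext => w; rewrite -!cats1; exact: (gM w [::]).
Qed.

(** An iterated coproduct is a combination of nonempty words, so the values at [[::]] may differ.
    This is the case for the counit of words compared with 0. *)
Lemma eq_ev n U (f g : seq H -> U) h : multilinear f -> multilinear g ->
  (forall x w, f (x :: w) = g (x :: w)) -> ev n f h = ev n g h.
Proof.
elim: n f g h => [|n IHn] f g h fM gM fg; first by rewrite !ev0.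
have [s hs] := tensor_sum (Delta h).
rewrite (evS _ fM hs) (evS _ gM hs); apply: eq_bigr => p _.
by congr (ev n _ _); apply/funext.
Qed.

Hypothesis coA : forall h,
  tassoc (tmap Delta id (Delta h)) = tmap id Delta (Delta h).

(** Coassociativity in Sweedler form: [T] induces a linear map on the threefold tensor product,
    which is applied to both sides of [coA]. *)
Lemma coassoc_trilinear U (T : H -> H -> H -> U) h (s : seq (H * H))
    (l : H -> seq (H * H)) :
  (forall y z, linear (fun x => T x y z)) ->
  (forall x z, linear (fun y => T x y z)) ->
  (forall x y, linear (fun z => T x y z)) ->
  Delta h = \sum_(p <- s) p.1 \ox p.2 ->
  (forall x, Delta x = \sum_(p <- l x) p.1 \ox p.2) ->
  \sum_(p <- s) \sum_(q <- l p.1) T q.1 q.2 p.2 =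
  \sum_(p <- s) \sum_(q <- l p.2) T p.1 q.1 q.2.
Proof.
move=> T1 T2 T3 hs hl.
pose T' x := tlift (T x).
have T'L x : linear (T' x) by exact: tlift_linear.
have T'x t : linear (T'^~ t).
  move=> a x y; have [u ->] := tensor_sum t.
  rewrite /T' !tlift_sum // scaler_sumr -big_split.
  by apply: eq_bigr => p _; rewrite T1.
have T''L : linear (tlift T') by exact: tlift_linear.
have T''E x y z : tlift T' (x \ox (y \ox z)) = T x y z.
  by rewrite (tliftE T'x T'L) [LHS](tliftE (fun z => T2 x z) (fun y => T3 x y)).
have DL : linear Delta by exact: linearP.
have El : tmap Delta id (Delta h) = \sum_(p <- s) Delta p.1 \ox p.2.
  rewrite hs [LHS]tlift_sum // => [w|v]; last exact: tens_linearr.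
  exact: (comp_linear (tens_linearl w) DL).
have Er : tmap id Delta (Delta h) = \sum_(p <- s) p.1 \ox Delta p.2.
  rewrite hs [LHS]tlift_sum // => [w|v]; first exact: tens_linearl.
  exact: (comp_linear (tens_linearr v) DL).
have := congr1 (tlift T') (coA h); rewrite {}El {}Er.
rewrite (lin_sum (@tassoc_linear _ _ _ _)) !(lin_sum T''L) => E.
transitivity (\sum_(p <- s) tlift T' (tassoc (Delta p.1 \ox p.2))).
  apply: eq_bigr => p _; rewrite hl tassoc_tens (lin_sum T''L).
  by apply: eq_bigr => q _; rewrite T''E.
rewrite E; apply: eq_bigr => p _; rewrite hl (lin_sum (tens_linearr _)).
by rewrite (lin_sum T''L); apply: eq_bigr => q _; rewrite T''E.
Qed.

(* [evS] expands Delta^{[n + 2]} = (Id (x) Delta^{[n + 1]}) Delta, whereas here it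
   is (Delta^{[n + 1]} (x) Id) Delta. *)
Lemma evSr n U (g : seq H -> U) h s : multilinear g ->
  Delta h = \sum_(p <- s) p.1 \ox p.2 ->
  ev n.+1 g h = \sum_(p <- s) ev n (fun w => g (rcons w p.2)) p.1.
Proof.
have rc (f : seq H -> U) x := @multilinear_rcons k H U f x.
have cn (f : seq H -> U) x := @multilinear_cons k H U f x.
elim: n g h s => [|n IHn] g h s gM hs.
  rewrite (evS _ gM hs); apply: eq_bigr => p _.
  by rewrite !ev0 //; [exact: rc|exact: cn].
have [l hl] := boolp.choice (fun x => tensor_sum (Delta x)).
rewrite (evS _ gM hs).
under eq_bigr do rewrite (IHn _ _ _ (cn _ _ gM) (hl _)).
under [RHS]eq_bigr do rewrite (evS _ (rc _ _ gM) (hl _)).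
apply/esym.
(* Both sides are now sums over the threefold coproduct: the outer factors become the first and last
   letters, and the middle one is split further by [ev n]. *)
pose T x y z := ev n (fun w => g (x :: rcons w z)) y.
apply: (@coassoc_trilinear _ T h s l _ _ _ hs hl) => [y z|x z|x y].
- exact: (ev_cons_linear n y (rc _ z gM)).
- exact: (ev_linear n (rc _ z (cn _ x gM))).
- exact: (ev_rcons_linear n y (cn _ x gM)).
Qed.

Section LocalFiniteness.
Variable F : nat -> set H.
Hypothesis hF : connected_filtration Delta F.

(** The words have [n + 1] letters, of total degree at most [m <= n]. Hence some letter has degree
    0, is a scalar by connectedness, and is killed by [g]. *)
Lemma ev_filt0 n U (g : seq H -> U) m h : multilinear g ->
  (forall u v, g (u ++ 1 :: v) = 0) -> F m h -> (m <= n)%N -> ev n g h = 0.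
Proof.
have F0 x : F 0%N x -> exists a, x = a *: 1.
  by rewrite (filt_connected hF) => -[a _ <-]; exists a.
elim: n g m h => [|n IHn] g m h gM g1 Fh.
  rewrite leqn0 => /eqP m0; rewrite m0 in Fh; have [a ->] := F0 _ Fh.
  by rewrite ev0 // (linZ (gM [::] [::])) (g1 [::]) scaler0.
move=> mn; have [s [hs Dh]] := filt_comult hF Fh.
rewrite (evS _ gM Dh) big_seq big1 // => -[x y] /hs [i /= [im Fx Fy]].
have [i0|i0] := posnP i.
  rewrite i0 in Fx; have [a ->] := F0 _ Fx.
  rewrite (linZ (ev_cons_linear n y gM)) ev_eq0 ?scaler0 // => w.
  exact: (g1 [::]).
apply: IHn Fy _; first exact: multilinear_cons.
- by move=> u v; exact: (g1 (x :: u)).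
- by rewrite leq_subLR (leq_trans mn) // -add1n leq_add2r.
Qed.

End LocalFiniteness.

End IteratedCoproduct.

(** * The transfer T(f, phi) as a truncated sum over iterated coproducts *)

Section Transfer.
Context {k : fieldType} {H : algType k}.
Variables (Delta : {linear H -> tensor H H}) (eta : {linear H -> k^o}).
Variable F : nat -> set H.
Hypotheses (hB : bialgebra Delta eta) (hF : connected_filtration Delta F).
Implicit Types (h : H) (n m M : nat).

Local Notation proj := (aug_proj eta).
Local Notation ev := (ev Delta).

Lemma filt_exhaust h : exists m, F m h.
Proof.
by have : (\bigcup_n F n)%classic h; [rewrite (filt_cover hF)|case=> m _; exists m].
Qed.

Lemma filt01 a : F 0%N (a *: 1).
Proof. by rewrite (filt_connected hF); exists a. Qed.

Lemma aug_proj_linear : linear proj.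
Proof.
move=> a x y; apply/val_inj; rewrite [RHS]linearP /= !(aug_projE _ (counit1 hB)).
by rewrite linearP scalerDl scalerBr scalerA /= opprD addrACA.
Qed.

Lemma aug_proj1 : proj 1 = 0.
Proof. by apply/val_inj; rewrite aug_projE ?(counit1 hB) // scale1r subrr. Qed.

(** Passing from [h] to its augmentation part subtracts a multiple of 1, on which every reduced
    coproduct vanishes. *)
Lemma red_coprod_iterE n h :
  red_coprod_iter Delta n (proj h) = ev n (fun w => word (map proj w)) h.
Proof.
have gM := st_map_multilinear aug_proj_linear.
rewrite [LHS](_ : _ = ev n (fun w => word (map proj w)) (val (proj h))) //.
rewrite (aug_projE _ (counit1 hB)) (linB (ev_linear _ n gM)).
rewrite (linZ (ev_linear _ n gM)).
rewrite [X in _ - _ *: X](ev_filt0 hF gM (m := 0)) ?scaler0 ?subr0 //.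
  move=> u v; rewrite map_cat /= aug_proj1.
  exact: (lin0 (word_multilinear _ _)).
by rewrite -[1]scale1r; exact: filt01.
Qed.

(** Terms with [n >= m] vanish by [ev_filt0]. The cutoff [M] is left free so that several elements
    can share one. *)
Lemma iota_stE m M h : F m h -> (m <= M)%N ->
  iota_st Delta eta h = (eta h : k) *: word [::] +
    \sum_(n < M) ev n (fun w => word (map proj w)) h.
Proof.
move=> Fh mM; congr (_ + _).
pose G n := ev n (fun w => word (map proj w)) h.
rewrite [RHS](fsbig_ord _ M G).
transitivity (\sum_(n \in [set: nat]) G n)%R.
  by apply: eq_fsbigr => n _; exact: red_coprod_iterE.
apply/esym; apply: fsbig_widen => // n [_ /negP]; rewrite -leqNgt => Mn.
apply: (ev_filt0 hF _ _ Fh (leq_trans mM Mn)) => [|u v].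
  exact/st_map_multilinear/aug_proj_linear.
by rewrite map_cat /= aug_proj1; exact: (lin0 (word_multilinear _ _)).
Qed.

Variables (A : algType k) (phi : H -> A).
Hypothesis phiU : inU 1 phi.

Definition red h : A := phi (val (proj h)).

Lemma red_linear : linear red.
Proof.
apply: (comp_linear phiU.1) => a x y.
by rewrite (aug_proj_linear a x y) [LHS]linearP.
Qed.

Lemma redE h : red h = phi h - (eta h : k) *: 1.
Proof.
by rewrite /red (aug_projE _ (counit1 hB)) (linB phiU.1) (linZ phiU.1) phiU.2.
Qed.

Lemma red1 : red 1 = 0.
Proof. by rewrite redE phiU.2 (counit1 hB) scale1r subrr. Qed.

(** Projection to the augmentation, phi^st and [f] merged into one multilinear function on words of
    H. It vanishes as soon as a letter is 1, so [ev_filt0] applies to it. *)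
Definition along_red {U : lmodType k} (f : st A -> U) (w : seq H) : U :=
  f (word (map red w)).

Lemma along_red_multilinear (U : lmodType k) (f : st A -> U) :
  linear f -> multilinear (along_red f).
Proof.
move=> fL u v; apply: (comp_linear fL).
exact: (st_map_multilinear red_linear).
Qed.

Lemma along_red_filt0 (U : lmodType k) (f : st A -> U) m n h :
  linear f -> F m h -> (m <= n)%N -> ev n (along_red f) h = 0.
Proof.
move=> fL Fh mn; apply: (ev_filt0 hF (along_red_multilinear fL) _ Fh mn) => u v.
rewrite /along_red map_cat /= red1 (lin0 (word_multilinear _ _)).
exact: lin0.
Qed.

Lemma transfer_ev (U : lmodType k) (f : st A -> U) m M h :
  linear f -> F m h -> (m <= M)%N ->
  f (phi_st phi (iota_st Delta eta h)) =
    (eta h : k) *: f (word [::]) + \sum_(n < M) ev n (along_red f) h.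
Proof.
move=> fL Fh mM.
have pL : linear (fun x : aug eta => phi (val x)).
  by apply: (comp_linear phiU.1) => a x y; rewrite [LHS]linearP.
have pM := st_map_multilinear pL.
have fpL := comp_linear fL (st_lift_linear pM).
rewrite (iota_stE Fh mM) [LHS](linD fpL) (linZ fpL) (lin_sum fpL).
rewrite st_liftE //=; congr (_ + _); apply: eq_bigr => n _.
rewrite (ev_comp _ _ _ fpL (st_map_multilinear aug_proj_linear)).
congr (ev n _ h); apply/funext => w.
by rewrite st_liftE // -map_comp.
Qed.

Lemma transfer_linear (U : lmodType k) (f : st A -> U) :
  linear f -> linear (fun h => f (phi_st phi (iota_st Delta eta h))).
Proof.
move=> fL; set g := fun h => _; move=> a x y.
have gE m M h : F m h -> (m <= M)%N ->
    g h = (eta h : k) *: f (word [::]) + \sum_(n < M) ev n (along_red f) h.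
  exact: transfer_ev.
have [mx Fx] := filt_exhaust x; have [my Fy] := filt_exhaust y.
have [mz Fz] := filt_exhaust (a *: x + y).
(* A common cutoff for the three elements, whose degrees were chosen independently. *)
pose M := maxn mz (maxn mx my).
rewrite (gE _ M _ Fz) ?leq_maxl //.
rewrite (gE _ M _ Fx) ?(leq_trans (leq_maxl mx my)) ?leq_maxr //.
rewrite (gE _ M _ Fy) ?(leq_trans (leq_maxr mx my)) ?leq_maxr //.
rewrite linearP scalerDl -scalerA scalerDr addrACA scaler_sumr -big_split.
congr (_ + _); apply: eq_bigr => n _.
exact: (ev_linear _ n (along_red_multilinear fL)).
Qed.

Lemma transfer1 (U : lmodType k) (f : st A -> U) :
  linear f -> f (phi_st phi (iota_st Delta eta 1)) = f (word [::]).
Proof.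
move=> fL; have F1 : F 0%N 1 by rewrite -[1]scale1r; exact: filt01.
by rewrite (transfer_ev (M := 0) fL F1) // big_ord0 addr0 (counit1 hB) scale1r.
Qed.

(** Compatibility of phi^st and iota with the counits: H' is sent into (A^st)', so a condition on
    [f] over (A^st)' becomes one on its transfer over H'. *)
Lemma st_counit_transfer h :
  st_counit (phi_st phi (iota_st Delta eta h)) = eta h.
Proof.
have cL : linear (@st_counit k A : st A -> k^o).
  exact/st_lift_linear/st_counit_multilinear.
have [m Fh] := filt_exhaust h.
rewrite [LHS](transfer_ev cL Fh (leqnn m)) st_counitE.
rewrite big1 ?addr0 => [|n _]; first exact: mulr1.
rewrite (@eq_ev _ _ _ _ _ _ (fun=> 0)) ?ev_eq0 //.
- exact: along_red_multilinear.
- by move=> u v a x y; rewrite scaler0 addr0.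
- by move=> x w; rewrite /along_red st_counitE.
Qed.

Lemma transfer_inU_sub (B : set A) (f : st A -> A) :
  inU_sub (@st_counit k A) (word [::]) B f ->
  inU_sub eta 1 B (transfer Delta eta f phi).
Proof.
move=> [[fL f1] fB]; split=> [|h h0]; last first.
  by apply: fB; rewrite st_counit_transfer.
by split; [exact: transfer_linear|rewrite /transfer transfer1].
Qed.

End Transfer.

(** * Convolution, and convolution with j on words *)

Section Convolution.
Context {k : fieldType} {A : algType k}.

Lemma conv_linear (K : lmodType k) (Delta : K -> tensor K K) (f g : K -> A) :
  linear Delta -> linear f -> linear g -> linear (conv Delta f g).
Proof.
move=> DL fL gL; apply: comp_linear DL; apply: tlift_linear => [y|x].
  exact: (comp_linear (mulr_linearl (g y)) fL).
exact: (comp_linear (mulr_linearr (f x)) gL).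
Qed.

Lemma convE (K : lmodType k) (Delta : K -> tensor K K) (f g : K -> A) h s :
  linear f -> linear g -> Delta h = \sum_(p <- s) p.1 \ox p.2 ->
  conv Delta f g h = \sum_(p <- s) f p.1 * g p.2.
Proof.
move=> fL gL hs; rewrite /conv hs tlift_sum // => [y|x].
  exact: (comp_linear (mulr_linearl (g y)) fL).
exact: (comp_linear (mulr_linearr (f x)) gL).
Qed.

Local Notation fj f := (conv (@st_coprod k A) f (@st_j k A)).

Lemma conv_st_j_word (f : st A -> A) w : linear f ->
  fj f (word w) = \sum_(i < (size w).+1)
    f (word (take i w)) * st_j (word (drop i w) : st A).
Proof.
move=> fL.
pose s := [seq (word (take i w), word (drop i w) : st A) | i <- index_iota 0 (size w).+1].
have hs : st_coprod (word w) = \sum_(p <- s) p.1 \ox p.2.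
  by rewrite st_coprodE big_map big_mkord.
by rewrite (convE fL (@st_j_linear _ _) hs) big_map big_mkord.
Qed.

Lemma conv_st_j_nil (f : st A -> A) : linear f -> fj f (word [::]) = f (word [::]).
Proof. by move=> fL; rewrite conv_st_j_word // big_ord1 st_jE mulr1. Qed.

Lemma conv_st_j_rcons (f : st A -> A) w a : linear f ->
  fj f (word (rcons w a)) = f (word (rcons w a)) + f (word w) * a.
Proof.
move=> fL; rewrite conv_st_j_word // size_rcons.
(* The two last cuts are split off; every other cut has [i < size w] and leaves at least two letters
   on the right, where j is 0. *)
rewrite !big_ord_recr big1 ?add0r => [|i _] /=; last first.
  rewrite st_jE; case E : (drop i _) => [|x [|y t]]; rewrite ?mulr0 //.
    by have := size_drop i (rcons w a); rewrite E size_rcons subSn // ltnW.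
  have := size_drop i (rcons w a); rewrite E size_rcons subSn ?(ltnW (ltn_ord i)) //.
  by move=> /= [/esym/eqP]; rewrite subn_eq0 leqNgt ltn_ord.
rewrite [take _.+1 _]take_oversize ?size_rcons //.
rewrite [drop _.+1 _]drop_oversize ?size_rcons //.
by rewrite -cats1 take_size_cat // drop_size_cat // !st_jE mulr1 add0r addrC.
Qed.

End Convolution.

(** * Transfer intertwines convolution with j and convolution with phi *)

Section TransferConvolution.
Context {k : fieldType} {H : algType k}.
Variables (Delta : {linear H -> tensor H H}) (eta : {linear H -> k^o}).
Variable F : nat -> set H.
Hypotheses (hB : bialgebra Delta eta) (hF : connected_filtration Delta F).
Variables (A : algType k) (phi : H -> A).
Hypothesis phiU : inU 1 phi.

Lemma counitl_sum h s : Delta h = \sum_(p <- s) p.1 \ox p.2 ->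
  \sum_(p <- s) (eta p.1 : k) *: p.2 = h.
Proof.
move=> hs; rewrite -[RHS](counitl hB) hs tlift_sum // => [y|x] a u v.
  by rewrite linearP scalerDl scalerA.
by rewrite scalerDr !scalerA mulrC.
Qed.

Lemma counitr_sum h s : Delta h = \sum_(p <- s) p.1 \ox p.2 ->
  \sum_(p <- s) (eta p.2 : k) *: p.1 = h.
Proof.
move=> hs; rewrite -[RHS](counitr hB) hs tlift_sum // => [y|x] a u v.
  by rewrite scalerDr !scalerA mulrC.
by rewrite linearP scalerDl scalerA.
Qed.

Lemma transfer_conv_st_j (f : st A -> A) : linear f ->
  conv Delta (transfer Delta eta f phi) phi =
  transfer Delta eta (conv (@st_coprod k A) f (@st_j k A)) phi.
Proof.
move=> fL; apply/funext => h.
set fj := conv _ f _.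
have fjL : linear fj.
  have DL := st_lift_linear (@st_coprod_multilinear k A).
  exact: (conv_linear DL fL (@st_j_linear _ _)).
have fj0 : fj (word [::]) = f (word [::]) by exact: conv_st_j_nil.
have fjr w a : fj (word (rcons w a)) = f (word (rcons w a)) + f (word w) * a.
  exact: conv_st_j_rcons.
clearbody fj.
(* By [fj0] and [fjr], this is the map [w a |-> f w * a], and it is 0 on the empty word. *)
pose g t := fj t - f t.
have gL : linear g := sub_linear fjL fL.
have fM := along_red_multilinear hB phiU fL.
have gM := along_red_multilinear hB phiU gL.
have [s hs] := tensor_sum (Delta h).
have [deg Fdeg] := boolp.choice (filt_exhaust hF).
(* This cutoff covers [h] and all left factors of its coproduct, so the same [S] computes all their
   transfers. *)
pose M := maxn (deg h) (\max_(p <- s) deg p.1).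
pose S x := \sum_(n < M) ev Delta n (along_red eta phi f) x.
have SL : linear S by apply: sum_linear => n; exact: ev_linear.
have trE x : (deg x <= M)%N ->
    transfer Delta eta f phi x = (eta x : k) *: f (word [::]) + S x.
  exact: (transfer_ev hB hF phiU fL (Fdeg x)).
(* One term more than in [S]: removing the last letter lowers the index by one, so the [g] part then
   runs over exactly [n < M]. *)
have trjE : transfer Delta eta fj phi h = (eta h : k) *: f (word [::]) +
    \sum_(n < M.+1) ev Delta n (along_red eta phi fj) h.
  rewrite -fj0.
  by apply: (transfer_ev hB hF phiU fjL (Fdeg h)); rewrite leqW ?leq_maxl.
have evj n : ev Delta n (along_red eta phi fj) h =
    ev Delta n (along_red eta phi f) h + ev Delta n (along_red eta phi g) h.
  rewrite -[X in X + _]scale1r -ev_lin; congr (ev Delta n _ h).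
  by apply/funext => w; rewrite /along_red /g scale1r addrC subrK.
have evg n : ev Delta n.+1 (along_red eta phi g) h =
    \sum_(p <- s) ev Delta n (along_red eta phi f) p.1 * red eta phi p.2.
  rewrite (evSr (coassoc hB) n gM hs); apply: eq_bigr => p _.
  rewrite (ev_comp _ _ _ (mulr_linearl _) fM); congr (ev Delta n _ _).
  apply/funext => w.
  by rewrite /along_red /g map_rcons fjr addrC addKr.
rewrite (convE (transfer_linear hB hF phiU fL) phiU.1 hs) trjE.
under [in RHS]eq_bigr do rewrite evj.
rewrite big_split /= big_ord_recr /=.
(* The extra term [n = M] of the [f] part vanishes, since [deg h <= M]. *)
rewrite (along_red_filt0 hB hF phiU fL (Fdeg h)) ?leq_maxl // addr0.
rewrite -/(S h) big_ord_recl ev0 // {1}/along_red /g /= (fjr [::]).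
under [in RHS]eq_bigr do rewrite evg.
rewrite exchange_big /=.
(* The product is expanded with [phi = red + eta 1] against [S] only, so that the two counit sums
   can be collapsed to [h]. *)
have -> : \sum_(p <- s) transfer Delta eta f phi p.1 * phi p.2 =
    f (word [::]) * phi (\sum_(p <- s) (eta p.1 : k) *: p.2) +
    (S (\sum_(p <- s) (eta p.2 : k) *: p.1) + \sum_(p <- s) S p.1 * red eta phi p.2).
  rewrite (lin_sum phiU.1) (lin_sum SL) mulr_sumr -!big_split.
  rewrite big_seq [RHS]big_seq; apply: eq_bigr => p ps.
  have pM : (deg p.1 <= M)%N.
    rewrite leq_max; apply/orP; right.
    exact: (leq_bigmax_seq (F := fun p => deg p.1) p ps).
  rewrite (trE _ pM) (linZ phiU.1) (linZ SL) (redE hB phiU) mulrDl.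
  by rewrite mulrBr -!scalerAr mulr1 -scalerAl [X in _ = _ + X]addrC subrK.
rewrite (counitl_sum hs) (counitr_sum hs) (redE hB phiU).
rewrite [f _ + _ - _]addrC addKr mulrBr -scalerAr mulr1.
rewrite [RHS]addrCA [X in _ = _ + X]addrA [_ + (_ - _)]addrC subrK addrCA.
do 2 congr (_ + _); by apply: eq_bigr => p _; rewrite mulr_suml.
Qed.

End TransferConvolution.

(** * The subalgebras A_+ (fixed points of p) and A_- (kernel of p) *)

Section RotaBaxter.
Context {k : fieldType} {A : algType k} (p : A -> A).
Hypothesis hp : Rota_Baxter p.

Lemma RB_range z : range p z <-> p z = z.
Proof.
by split=> [[u _ <-]|<-]; [exact: RB_idem|exists z].
Qed.

Lemma RB_range_compl z : range (fun x => x - p x) z <-> p z = 0.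
Proof.
split=> [[u _ <-]|pz]; last by exists z => //; rewrite pz subr0.
by rewrite (linB (RB_linear hp)) RB_idem // subrr.
Qed.

(** Three of the four terms of the Rota-Baxter identity become [p (x * y)], and the fourth is
    [x * y]. *)
Lemma RB_rangeM x y : p x = x -> p y = y -> p (x * y) = x * y.
Proof.
move=> px py; have := RB_eq hp x y; rewrite px py => /addIr.
by move=> <-.
Qed.

Lemma RB_kerM x y : p x = 0 -> p y = 0 -> p (x * y) = 0.
Proof.
move=> px py; have := RB_eq hp x y.
by rewrite px py !mulr0 !mul0r (lin0 (RB_linear hp)) !add0r.
Qed.

End RotaBaxter.

(** * Multiplicativity of the Birkhoff factors of a character *)

Section Characters.
Context {k : fieldType} {H : algType k}.
Variables (Delta : {linear H -> tensor H H}) (eta : {linear H -> k^o}).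
Variable F : nat -> set H.
Hypotheses (hB : bialgebra Delta eta) (hF : connected_filtration Delta F).
Variables (A : algType k).
Implicit Types (f : H -> A) (x y : H) (s t : seq (H * H)).

Definition defect f x y : A := f (x * y) - f x * f y.

Lemma defect_linearl f y : linear f -> linear (fun x => defect f x y).
Proof.
move=> fL; apply: sub_linear.
  exact: (comp_linear fL (mulr_linearl y)).
exact: (comp_linear (mulr_linearl (f y)) fL).
Qed.

Lemma defect_linearr f x : linear f -> linear (fun y => defect f x y).
Proof.
move=> fL; apply: sub_linear.
  exact: (comp_linear fL (mulr_linearr x)).
exact: (comp_linear (mulr_linearr (f x)) fL).
Qed.

(** The defect is bilinear and vanishes when either argument is 1. This moves both arguments into
    ker eta, the only place where membership of the values in A_+ or A_- is known. *)
Lemma defect_aug f x y : inU 1 f ->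
  defect f x y = defect f (x - (eta x : k) *: 1) (y - (eta y : k) *: 1).
Proof.
move=> [fL f1].
rewrite (linB (defect_linearl _ fL)) (linZ (defect_linearl _ fL)).
rewrite [X in _ - _ *: X](_ : _ = 0) ?scaler0 ?subr0; last first.
  by rewrite /defect f1 !mul1r subrr.
rewrite (linB (defect_linearr _ fL)) (linZ (defect_linearr _ fL)).
rewrite [X in _ - _ *: X](_ : _ = 0) ?scaler0 ?subr0 //.
by rewrite /defect f1 !mulr1 subrr.
Qed.

Lemma defect_in (B : set A) f x y :
  (forall u v, B u -> B v -> B (u - v)) -> (forall u v, B u -> B v -> B (u * v)) ->
  inU_sub eta 1 B f -> B (defect f x y).
Proof.
move=> BB BM [fU fB]; rewrite defect_aug //.
have eta0 z : eta (z - (eta z : k) *: 1) = 0.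
  by rewrite linearB linearZ /= (counit1 hB) [_ *: _]mulr1 subrr.
apply: BB; last by apply: BM; apply: fB; exact: eta0.
by apply: fB; rewrite (counitM hB) eta0 mul0r.
Qed.

Lemma comult_mul x y s t :
  Delta x = \sum_(q <- s) q.1 \ox q.2 -> Delta y = \sum_(r <- t) r.1 \ox r.2 ->
  Delta (x * y) =
    \sum_(q <- [seq (q.1 * r.1, q.2 * r.2) | q <- s, r <- t]) q.1 \ox q.2.
Proof.
move=> hs ht; rewrite (comultM hB) big_allpairs_dep /tmul /= hs ht.
have L1 b c d : linear (fun a : H => (a * c) \ox (b * d)).
  exact: (comp_linear (tens_linearl (b * d)) (mulr_linearl c)).
have L2 a c d : linear (fun b : H => (a * c) \ox (b * d)).
  exact: (comp_linear (tens_linearr (a * c)) (mulr_linearl d)).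
have L3 a b d : linear (fun c : H => (a * c) \ox (b * d)).
  exact: (comp_linear (tens_linearl (b * d)) (mulr_linearr a)).
have L4 a b c : linear (fun d : H => (a * c) \ox (b * d)).
  exact: (comp_linear (tens_linearr (a * c)) (mulr_linearr b)).
rewrite tlift_sum.
- apply: eq_bigr => q _.
  have E := @tlift_sum k _ _ _ (fun c d => (q.1 * c) \ox (q.2 * d)) t.
  by apply: E => [d|c]; [exact: L3|exact: L4].
- by move=> b; apply: tlift_param_linear => c d; exact: L1.
- by move=> a; apply: tlift_param_linear => c d; exact: L2.
Qed.

Variable (phi : H -> A).
Hypotheses (mulAC : forall a b : A, a * b = b * a) (phiC : inC phi).

(** Multiplicativity of [phi] splits [phi (q.2 * r.2)], and commutativity of A moves [phi q.2] past
    [f r.1]. *)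
Lemma defect_conv f x y s t : linear f ->
  Delta x = \sum_(q <- s) q.1 \ox q.2 -> Delta y = \sum_(r <- t) r.1 \ox r.2 ->
  defect (conv Delta f phi) x y =
    \sum_(q <- s) \sum_(r <- t) defect f q.1 r.1 * (phi q.2 * phi r.2).
Proof.
move=> fL hs ht; have phiL := phiC.1.1.
rewrite /defect (convE fL phiL (comult_mul hs ht)) big_allpairs_dep.
rewrite (convE fL phiL hs) (convE fL phiL ht) mulr_suml -sumrB.
apply: eq_bigr => q _; rewrite mulr_sumr -sumrB; apply: eq_bigr => r _ /=.
rewrite phiC.2 mulrBl; congr (_ - _).
by rewrite -!mulrA; congr (_ * _); rewrite mulrA [_ * f _]mulAC -mulrA.
Qed.

Variables (p : A -> A) (phip phim : H -> A).
Hypothesis hp : Rota_Baxter p.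
Hypothesis dec : Birkhoff_decomp Delta eta 1 p phi phip phim.

Lemma RB_defectp x y : p (defect phip x y) = defect phip x y.
Proof.
have [dp _ _] := dec; apply/(RB_range hp); apply: defect_in dp => u v.
  move=> /(RB_range hp) pu /(RB_range hp) pv; apply/(RB_range hp).
  by rewrite (linB (RB_linear hp)) pu pv.
move=> /(RB_range hp) pu /(RB_range hp) pv; apply/(RB_range hp).
exact: RB_rangeM.
Qed.

Lemma RB_defectm x y : p (defect phim x y) = 0.
Proof.
have [_ dm _] := dec; apply/(RB_range_compl hp); apply: defect_in dm => u v.
  move=> /(RB_range_compl hp) pu /(RB_range_compl hp) pv; apply/(RB_range_compl hp).
  by rewrite (linB (RB_linear hp)) pu pv subrr.
move=> /(RB_range_compl hp) pu /(RB_range_compl hp) pv; apply/(RB_range_compl hp).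
exact: RB_kerM.
Qed.

Lemma defect_filt0 n m x y : F n x -> F m y ->
  defect phim x y = 0 /\ defect phip x y = 0.
Proof.
have [_ [[phimL _] _] convE'] := dec.
(* Strong induction on the total degree [n + m]. *)
have [N] := ubnP (n + m); elim: N n m x y => // N IHN n m x y nmN Fx Fy.
have [s [Fs hs]] := filt_comult hF Fx; have [t [Ft ht]] := filt_comult hF Fy.
have top i u d : F (d - i)%N u -> (i = d)%N -> phi u = (eta u : k) *: 1.
  move=> + id; rewrite id subnn (filt_connected hF) => -[a _ <-].
  rewrite (linZ phiC.1.1) phiC.1.2; congr (_ *: _).
  by rewrite linearZ /= (counit1 hB) [RHS]mulr1.
have E : defect phip x y = defect phim x y.
  rewrite -[in LHS]convE' (defect_conv phimL hs ht).
  (* The right counit rewrites [x] and [y] over the same decompositions, with eta where the left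
     side has [phi]; the two sums are then compared term by term. *)
  rewrite -[in RHS](counitr_sum hB hs) -[in RHS](counitr_sum hB ht).
  rewrite (lin_sum (defect_linearl _ phimL)) big_seq [RHS]big_seq.
  apply: eq_bigr => q /Fs [i [iN F1 F2]].
  rewrite (linZ (defect_linearl _ phimL)) (lin_sum (defect_linearr _ phimL)).
  rewrite scaler_sumr big_seq [RHS]big_seq.
  apply: eq_bigr => r /Ft [j [jN F3 F4]].
  rewrite (linZ (defect_linearr _ phimL)).
  (* Below the top degree both terms vanish by induction. Otherwise [i = n] and [j = m], so the
     right factors have degree 0 and [phi] agrees with eta on them. *)
  have [ij|ij] := ltnP (i + j) (n + m).
    by rewrite (IHN _ _ _ _ (leq_trans ij nmN) F1 F3).1 !scaler0 mul0r.
  rewrite (top _ _ _ F2) ?(top _ _ _ F4) //.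
  - by rewrite -scalerAl mul1r -!scalerAr mulr1.
  - apply/eqP; rewrite eqn_leq jN; rewrite -(leq_add2l n).
    by apply: leq_trans ij _; rewrite leq_add2r.
  - apply/eqP; rewrite eqn_leq iN; rewrite -(leq_add2r m).
    by apply: leq_trans ij _; rewrite leq_add2l.
(* The common value is fixed by p as a defect of [phip] and killed by p as a defect of [phim]. *)
have m0 : defect phim x y = 0.
  by rewrite -E -RB_defectp E RB_defectm.
by rewrite E m0.
Qed.

Lemma Birkhoff_decomp_inC : inC phip /\ inC phim.
Proof.
have [[pU _] [mU _] _] := dec.
have d0 x y : defect phim x y = 0 /\ defect phip x y = 0.
  have [n Fx] := filt_exhaust hF x; have [m Fy] := filt_exhaust hF y.
  exact: defect_filt0 Fx Fy.
by split; split=> // x y; apply/eqP; rewrite -subr_eq0; apply/eqP;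
  have [] := d0 x y.
Qed.

End Characters.

Theorem mainTheorem5 (k : fieldType) (H : algType k)
    (Delta : {linear H -> tensor H H}) (eta : {linear H -> k^o})
    (A : algType k) (p : A -> A)
    (jp jm : st A -> A) (phi : H -> A) :
  connected_bialgebra Delta eta ->
  Rota_Baxter p ->
  st_Birkhoff_decomp p st_j jp jm ->
  inU 1 phi ->
  let phip := transfer Delta eta jp phi in
  let phim := transfer Delta eta jm phi in
  Birkhoff_decomp Delta eta 1 p phi phip phim /\
  ((forall x y : A, x * y = y * x) -> inC phi -> inC phip /\ inC phim).
Proof.
move=> [hB [F hF]] hp [jpU jmU jE] phiU phip phim.
have dec : Birkhoff_decomp Delta eta 1 p phi phip phim.
  split; first exact: (transfer_inU_sub hB hF phiU jpU).
    exact: (transfer_inU_sub hB hF phiU jmU).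
  by rewrite (transfer_conv_st_j hB hF phiU jmU.1.1) jE.
by split=> // mulAC phiC; exact: (Birkhoff_decomp_inC hB hF mulAC phiC hp dec).
Qed.
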